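(* Let $(X,\mathcal{B}_X,\mu,T)$ be a $\mathbb{Z}^2$-MPS and $\vec{v}=(1,\beta)\in\mathbb{R}^2$ be a direction vector. Then the following two conditions are equivalent. (a) $\mu$ has $\vec{v}$-discrete spectrum. (b) $(X,\mathcal{B}_X,\mu,T)$ is $\vec{v}$-null.
   Context: A $\mathbb{Z}^2$-measure preserving dynamical system ($\mathbb{Z}^2$-MPS) is a quadruple $(X,\mathcal{B}_X,\mu,T)$ where $X$ is a compact metric space, $\mathcal{B}_X$ its Borel $\sigma$-algebra, $T$ assigns to each $\vec{w}\in\mathbb{Z}^2$ a homeomorphism $T^{\vec{w}}:X\to X$ with $T^{\vec{w}}\circ T^{\vec{u}}=T^{\vec{w}+\vec{u}}$ and $T^{\vec{0}}=\mathrm{id}_X$, and $\mu$ is a Borel probability measure on $X$ invariant under every $T^{\vec{w}}$. For $\vec{v}=(1,\beta)\in\mathbb{R}^2$ and $b>0$ put $\Lambda^{\vec{v}}(b)=\{(m,n)\in\mathbb{Z}^2:\beta m-b/2\leq n\leq \beta m+b/2\}$. For a finite measurable partition $\alpha$, $H_\mu(\alpha)=-\sum_{A\in\alpha}\mu(A)\log\mu(A)$ (with $0\log 0=0$). An infinite subset $S=\{(m_i,n_i)\}_{i=1}^\infty$ of $\mathbb{Z}^2$ is understood to come with an enumeration as a sequence of pairwise distinct elements; put $$h^S_{\mu}(T,\alpha)=\limsup_{k\to\infty}\frac1k H_\mu\left(\bigvee_{i=1}^k T^{-(m_i,n_i)}\alpha\right),\qquad h^S_\mu(T)=\sup_\alpha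 h^S_\mu(T,\alpha),$$ the supremum being over all finite measurable partitions $\alpha$ of $X$. Let $U_T^{(m,n)}f=f\circ T^{(m,n)}$ for $f\in L^2(X,\mathcal{B}_X,\mu)$. The $\vec{v}$-directional Kronecker algebra is $$\mathcal{K}_\mu^{\vec{v}}=\left\{B\in\mathcal{B}_X:\overline{\{U_T^{(m,n)}1_B:(m,n)\in\Lambda^{\vec{v}}(b)\}}\text{ is compact in }L^2(X,\mathcal{B}_X,\mu)\right\};$$ it is a $\sigma$-algebra and does not depend on the choice of $b\in(0,\infty)$. $\mu$ has $\vec{v}$-discrete spectrum if $\mathcal{K}_\mu^{\vec{v}}=\mathcal{B}_X$. The system $(X,\mathcal{B}_X,\mu,T)$ is $\vec{v}$-null if for any $b\in(0,\infty)$ and any infinite subset $S=\{(m_i,n_i)\}_{i=1}^\infty$ of $\Lambda^{\vec{v}}(b)$, $h^S_\mu(T)=0$. *)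

(* Defs.v *)
From HB Require Import structures.
From mathcomp Require Import all_boot all_order all_algebra.
From mathcomp Require Import all_classical all_reals all_analysis.
From mathcomp Require Import ess_sup_inf measurable_realfun.

Set Implicit Arguments.
Unset Strict Implicit.
Unset Printing Implicit Defensive.

Import Order.TTheory GRing.Theory Num.Theory.
Import numFieldNormedType.Exports.

Local Open Scope classical_set_scope.
Local Open Scope ring_scope.

Section Lspace_metric.
Context d (T : measurableType d) (R : realType).
Variables (mu : {measure set T -> \bar R}) (p : \bar R).

Let LnormN (h : T -> R) : ('N[mu]_p [EFin \o (\- h)%R] = 'N[mu]_p [EFin \o h])%E.
Proof.
by rewrite (_ : _ \o _ = \- (EFin \o h))%E//; exact: oppe_Lnorm.
Qed.

Lemma measurable_abse_poweR (r : R) (h : T -> \bar R) :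
  measurable_fun [set: T] h -> measurable_fun [set: T] (fun x => `|h x| `^ r)%E.
Proof.
move=> mh; apply: (@measurableT_comp _ _ _ _ _ _ (fun x => x `^ r)%E) => //=.
  exact: (measurableT_comp (measurable_poweR _)).
exact: measurableT_comp.
Qed.

Lemma ae_eq_Lnorm (f g : T -> R) :
  measurable_fun [set: T] f -> measurable_fun [set: T] g ->
  f = g %[ae mu] -> ('N[mu]_p [EFin \o f] = 'N[mu]_p [EFin \o g])%E.
Proof.
move=> mf mg fg; rewrite unlock /Lnorm; case: p => [r| |].
- have mf' := measurable_abse_poweR r ((measurable_EFinP _ _).2 mf).
  have mg' := measurable_abse_poweR r ((measurable_EFinP _ _).2 mg).
  rewrite (ae_eq_integral _ _ measurableT mf' mg')//.
  by apply: filterS fg => x /= fgx _; rewrite fgx.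
- case: ifPn => // _; apply: eq_ess_sup.
  by apply: filterS fg => x /= ->.
- case: ifPn => // _; apply: eq_ess_inf.
  by apply: filterS fg => x /= ->.
Qed.

Variable p1 : (1 <= p)%E.
Local Notation Lp := (LspaceType mu p1).

(* The chosen representative of a class of functions modulo a.e. equality. *)
Definition Lspace_fun (f : Lp) : T -> R := aqEqMfun_to_fun (LebesgueSpace.sort f).

Lemma measurable_Lspace_fun (f : Lp) : measurable_fun [set: T] (Lspace_fun f).
Proof. exact: (measurable_funPT (repr (LebesgueSpace.sort f))). Qed.

Lemma finite_norm_Lspace_fun (f : Lp) : finite_norm mu p (Lspace_fun f).
Proof. exact: Lebesgue_finite. Qed.

Lemma Lspace_eqP (f g : Lp) : Lspace_fun f = Lspace_fun g %[ae mu] -> f = g.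
Proof.
move=> fg.
have : LebesgueSpace.sort f = LebesgueSpace.sort g.
  by have /eqP := introT (@ae_eqP _ _ R T (measurableTypeR R) mu (LebesgueSpace.sort f)
    (LebesgueSpace.sort g)) fg; rewrite !reprK.
case: f g {fg} => f [[Pf]] [g [[Pg]]] /= fg.
by subst g; rewrite (Prop_irrelevance Pf Pg).
Qed.

Let dist_fin (f g : Lp) :
  ('N[mu]_p [EFin \o (Lspace_fun f \- Lspace_fun g)%R] < +oo)%E.
Proof.
have := @eminkowski _ _ _ mu _ (\- Lspace_fun g)%R p
  (measurable_Lspace_fun f) (measurable_funN (measurable_Lspace_fun g)) p1.
rewrite LnormN => /le_lt_trans; apply.
by rewrite lte_add_pinfty//; exact: finite_norm_Lspace_fun.
Qed.

Definition Lspace_dist (f g : Lp) : R :=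
  fine 'N[mu]_p [EFin \o (Lspace_fun f \- Lspace_fun g)%R]%E.

Lemma Lspace_distE (f g : Lp) : (Lspace_dist f g)%:E =
  'N[mu]_p [EFin \o (Lspace_fun f \- Lspace_fun g)%R]%E.
Proof.
by rewrite fineK// fin_numElt (lt_le_trans ltNy0) ?Lnorm_ge0//=; exact: dist_fin.
Qed.

Let distxx (f : Lp) : Lspace_dist f f = 0.
Proof.
apply: EFin_inj; rewrite Lspace_distE (_ : _ \o _ = cst 0%E); last first.
  by apply/funext => x /=; rewrite subrr.
by rewrite Lnorm0// gt_eqF// (lt_le_trans _ p1).
Qed.

Let dist_eq0 (f g : Lp) : Lspace_dist f g = 0 -> f = g.
Proof.
move=> fg; apply: Lspace_eqP.
have := Lspace_distE f g; rewrite fg => /esym fg0.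
have mB : measurable_fun [set: T] (EFin \o (Lspace_fun f \- Lspace_fun g)%R).
  by apply/measurable_EFinP/measurable_funB; exact: measurable_Lspace_fun.
have := Lnorm_eq0_eq0 mB (lt_le_trans lte01 p1) fg0.
apply: filterS => x h _; have [fgx] := h I.
by apply/eqP; rewrite -subr_eq0; apply/eqP.
Qed.

Let dist_sym (f g : Lp) : Lspace_dist f g = Lspace_dist g f.
Proof.
congr fine; rewrite -LnormN; congr Lnorm.
by apply/funext => x /=; rewrite opprB.
Qed.

Let dist_triangle (g f h : Lp) :
  Lspace_dist f h <= Lspace_dist f g + Lspace_dist g h.
Proof.
rewrite -lee_fin EFinD !Lspace_distE.
rewrite (_ : EFin \o (Lspace_fun f \- Lspace_fun h) = EFin \o
  ((Lspace_fun f \- Lspace_fun g) \+ (Lspace_fun g \- Lspace_fun h)))%R.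
  by apply: eminkowski => //; apply: measurable_funB;
    exact: measurable_Lspace_fun.
by apply/funext => x /=; rewrite addrA subrK.
Qed.

(* Lp carries the metric, hence the topology, given by its norm. *)
HB.instance Definition _ := gen_eqMixin Lp.
HB.instance Definition _ := gen_choiceMixin Lp.
HB.instance Definition _ :=
  isMetric.Build R Lp distxx dist_eq0 dist_sym dist_triangle.

Section Lspace_class.
Variables (f : T -> R) (mf : measurable_fun [set: T] f).
Hypothesis finf : finite_norm mu p f.

Let F : {mfun T >-> measurableTypeR R} :=
  HB.pack f (isMeasurableFun.Build _ _ _ (measurableTypeR R) f mf).
Let cF : {mfun_ mu, T >-> measurableTypeR R} := (\pi F)%qT.

Let cFE : aqEqMfun_to_fun cF = f %[ae mu].
Proof.
have : (repr cF == F %[mod {mfun_ mu, T >-> measurableTypeR R}])%qT.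
  by rewrite reprK.
by rewrite eqmodE => /asboolP.
Qed.

Let fincF : finite_norm mu p (aqEqMfun_to_fun cF).
Proof.
rewrite /finite_norm (ae_eq_Lnorm _ mf cFE)//.
exact: (measurable_funPT (repr cF)).
Qed.

Definition Lspace_class : Lp := HB.pack cF
  (isFinLebesgue.Build _ _ _ _ _ p1 cF fincF).

Lemma Lspace_classE : Lspace_fun Lspace_class = f %[ae mu].
Proof. exact: cFE. Qed.
End Lspace_class.

End Lspace_metric.

#[short(type="pmetricType")]
HB.structure Definition PointedMetric (K : numDomainType) :=
  {M of Pointed M & Metric K M}.

Definition homeomorphism {X Y : topologicalType} (f : X -> Y) :=
  continuous f /\
  exists g : Y -> X, [/\ continuous g, cancel f g & cancel g f].

Definition borel (X : ptopologicalType) := g_sigma_algebraType (@open X).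

(* The base point of the phase space, which measurableType requires, is
   harmless: a space with a probability measure is nonempty. *)
Record Z2MPS (R : realType) := {
  phase :> pmetricType R ;
  phase_compact : compact [set: phase] ;
  law : probability (borel phase) R ;
  act : int * int -> phase -> phase ;
  act_homeomorphism : forall w, homeomorphism (act w) ;
  actD : forall w u, act w \o act u = act (w + u) ;
  act0 : act 0 = id ;
  act_invariant : forall w (B : set (borel phase)),
    measurable B -> law (act w @^-1` B) = law B
}.

Arguments act {R} _ _ _.
Arguments act_homeomorphism {R} _ _.
Arguments act_invariant {R} _ _ _ _.

Definition strip {R : realType} (beta b : R) : set (int * int) :=
  [set w | beta * w.1%:~R - b / 2 <= w.2%:~R <= beta * w.1%:~R + b / 2].

Section directional.
Context {R : realType} (X : Z2MPS R).
Local Notation mu := (law X).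
Local Notation T := (act X).
Local Notation L2 := (LspaceType mu (lee1n 2)).

Lemma measurable_act w : measurable_fun [set: borel X] (T w : borel X -> borel X).
Proof.
have [cT _] := act_homeomorphism X w.
apply: (@measurability _ _ (borel X) (borel X) setT (T w) (@open X)) => //.
move=> _ [U oU <-].
by rewrite setTI; apply: sub_sigma_algebra; exact: open_comp (in1W cT) oU.
Qed.

Lemma finite_norm_act w (f : borel X -> R) :
  measurable_fun [set: borel X] f ->
  finite_norm mu 2%:E f -> finite_norm mu 2%:E (f \o T w).
Proof.
rewrite /finite_norm unlock /Lnorm => mf.
suff -> : (\int[mu]_x `|(EFin \o f) x| `^ 2 =
           \int[mu]_x `|(EFin \o (f \o T w)) x| `^ 2)%E by [].
have mh := measurable_abse_poweR 2 ((measurable_EFinP _ _).2 mf).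
rewrite -(ge0_integral_pushforward (measurable_act w) mu measurableT mh).
  apply: eq_measure_integral => [|mT B mB _].
    exact: measurable_act.
  exact: esym (act_invariant X w B mB).
by move=> x _; exact: poweR_ge0.
Qed.

(* U_T^w f = f o T^w *)
Definition koopman (w : int * int) (f : L2) : L2 :=
  Lspace_class (lee1n 2)
    (measurableT_comp (measurable_Lspace_fun f) (measurable_act w))
    (finite_norm_act w (measurable_Lspace_fun f) (finite_norm_Lspace_fun f)).

Lemma finite_norm_indic (B : set (borel X)) : measurable B ->
  finite_norm mu 2%:E (\1_B : borel X -> R).
Proof.
move=> mB; rewrite /finite_norm unlock /Lnorm poweR_lty//.
have -> : (\int[mu]_x `|(EFin \o (\1_B : borel X -> R)) x| `^ 2 =
    \int[mu]_x (\1_B x)%:E)%E.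
  apply: eq_integral => x _; rewrite /= indicE.
  by case: (x \in B); rewrite ?normr1 ?powR1 ?normr0 ?powR0.
by rewrite integral_indic// setIT (le_lt_trans (probability_le1 mu mB))// ltry.
Qed.

Definition indicL2 (B : set (borel X)) (mB : measurable B) : L2 :=
  Lspace_class (lee1n 2) (measurable_indic mB) (finite_norm_indic mB).
Lemma ae_eq_act w (f g : borel X -> R) :
  f = g %[ae mu] -> f \o T w = g \o T w %[ae mu].
Proof.
move=> [N [mN N0 fgN]]; exists (T w @^-1` N); split.
- by rewrite -[X in measurable X]setTI; exact: measurable_act.
- by rewrite -N0; exact: act_invariant.
- by move=> x /= fgx; apply: fgN.
Qed.

Lemma koopmanE w (f : L2) :
  Lspace_fun (koopman w f) = Lspace_fun f \o T w %[ae mu].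
Proof. exact: Lspace_classE. Qed.

Lemma koopman_indicE w (B : set (borel X)) (mB : measurable B) :
  Lspace_fun (koopman w (indicL2 mB)) = \1_(T w @^-1` B) %[ae mu].
Proof.
have := ae_eq_act w (Lspace_classE (lee1n 2) (measurable_indic mB)
  (finite_norm_indic mB)).
have := koopmanE w (indicL2 mB).
by apply: filterS2 => x h1 h2 xT; rewrite h1//; exact: h2.
Qed.

(* This set does not depend on the choice of b > 0. *)
Definition directional_kronecker (beta b : R) : set (set (borel X)) :=
  [set B | exists mB : measurable B,
     compact (closure [set koopman w (indicL2 mB) | w in strip beta b])].

Definition directional_discrete_spectrum (beta b : R) :=
  directional_kronecker beta b = (measurable : set (set (borel X))).

Definition measurable_partition n (A : 'I_n -> set (borel X)) :=
  (forall i, measurable (A i)) /\ partition [set: 'I_n] A [set: borel X].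

(* Also used for families with empty cells, which contribute 0. *)
Definition entropy (J : finType) (A : J -> set (borel X)) : R :=
  - \sum_(j : J) fine (mu (A j)) * ln (fine (mu (A j))).

(* The join of the T^{-s_i} A for i < k; its cells are indexed by itineraries. *)
Definition join_pullback n (A : 'I_n -> set (borel X)) (s : nat -> int * int) k
    (j : {ffun 'I_k -> 'I_n}) : set (borel X) :=
  \bigcap_(i in [set: 'I_k]) (T (s i) @^-1` A (j i)).

Definition seq_entropy_of (s : nat -> int * int) n (A : 'I_n -> set (borel X)) :
    \bar R :=
  limn_esup (fun k => (k%:R^-1 * entropy (@join_pullback n A s k))%:E).

Definition seq_entropy (s : nat -> int * int) : \bar R :=
  ereal_sup [set h | exists n (A : 'I_n -> set (borel X)),
    measurable_partition A /\ h = seq_entropy_of s A].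

(* An infinite subset of the strip is given by an injective enumeration s. *)
Definition directional_null (beta : R) :=
  forall b : R, 0 < b -> forall s : nat -> int * int,
    injective s -> (forall i, strip beta b (s i)) -> seq_entropy s = 0%E.
End directional.

Arguments directional_discrete_spectrum {R} X beta b.
Arguments directional_null {R} X beta.

(* Main.v *)
Require Import Defs.
From mathcomp Require Import all_boot all_order all_algebra.
From mathcomp Require Import all_classical all_reals all_analysis.
From mathcomp Require Import measurable_realfun ring lra.

(** The objects of the proof are finite-valued observables of the phase space,
    compared by the probability that they differ; for two indicator functions
    this is the square of their L2 distance.  An observable f is almost
    periodic along a set L of vectors when, at every scale e, the translates
    f o T^w with w in L split into finitely many classes of diameter less
    than e.  For an indicator function this total boundedness amounts to
    compactness of the orbit closure (compact_orbit_iff): the only limits to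
    be produced are limits of translates of one set, and a fast Cauchy sequence
    of sets converges to its limit inferior (fast_Cauchy_sets).

    Discrete spectrum implies nullity.  Almost periodicity passes from sets to
    finite partitions, by a product of classifications, and from a strip to
    any wider one, which is covered by finitely many translates of the first.
    Given a partition A and a small delta, finitely many translates T^-u A
    then predict each T^-(s_i) A up to an error of probability delta.  Hence
    the itinerary of length k is a noisy reading of a bounded amount of
    information, and comparing its law with that of the noisy reading bounds
    its entropy by C + k eta, where eta can be made small and C does not depend
    on k (obs_entropy_le_of_guesses).

    Nullity implies discrete spectrum.  Adding a set B to a finite partition
    raises the entropy at least by the distance from B to the nearest union of
    cells (exists_coarse_guess).  If the orbit of B along the strip is not
    totally bounded at scale e, then after any finite choice of translates of B
    some further translate is at distance at least e/2 from all unions of cells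
    of the partition they generate: there are only finitely many such unions,
    and otherwise the nearest one would classify the orbit.  Choosing these
    translates one after the other gives a sequence in the strip along which
    the first k translates of {B, ~B} have joint entropy at least k e/2. *)

Set Implicit Arguments.
Unset Strict Implicit.
Unset Printing Implicit Defensive.

Import Order.TTheory GRing.Theory Num.Theory.
Import numFieldNormedType.Exports.

Local Open Scope classical_set_scope.
Local Open Scope ring_scope.

(** * Entropy estimates for finite probability vectors *)

Section FiniteEntropy.
Context {R : realType}.
Implicit Types p q m : R.

Lemma ln_le_subr1 q : 0 < q -> ln q <= q - 1.
Proof. by move=> q0; rewrite -{1}[q](subrKC 1) le_ln1Dx//; lra. Qed.

(** The summand of Gibbs' inequality, from ln x <= x - 1 at x = q / p. *)
Lemma gibbs_term p q : 0 <= p -> 0 < q -> p * ln q - p * ln p <= q - p.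
Proof.
rewrite le_eqVlt => /predU1P[<- q0|p0 q0]; first by rewrite !mul0r; lra.
rewrite -mulrBr -ln_div ?posrE//.
have := ln_le_subr1 (divr_gt0 q0 p0).
by rewrite -(ler_pM2l p0) mulrBr mulr1 mulrCA divff ?gt_eqF ?mulr1.
Qed.

Lemma gibbs (I : finType) (p q : I -> R) :
    (forall i, 0 <= p i) -> (forall i, 0 < q i) -> \sum_i q i <= \sum_i p i ->
  - \sum_i p i * ln (p i) <= - \sum_i p i * ln (q i).
Proof.
move=> p0 q0 qp; rewrite -subr_le0 opprK addrC -sumrB.
apply: (@le_trans _ _ (\sum_i (q i - p i))).
  by apply: ler_sum => i _; exact: gibbs_term.
by rewrite sumrB subr_le0.
Qed.

(** The same bound on the logarithm, at x = p / m: a cell of mass p inside a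
    cell of mass m contributes at least p (1 - p / m) to the entropy gained by
    the refinement. *)
Lemma gain_term p m : 0 <= p <= m -> p - p * (p / m) <= p * ln m - p * ln p.
Proof.
rewrite le_eqVlt => /andP[/predU1P[<- m0|p0 pm]]; first by rewrite !mul0r subrr.
have m0 := lt_le_trans p0 pm.
have := ln_le_subr1 (divr_gt0 p0 m0).
rewrite -(ler_pM2l p0) ln_div ?posrE// !mulrBr mulr1; lra.
Qed.

(** The right side is the harmonic mean of p and q, and equals 2 p q / (p + q)
    with the convention 0 / 0 = 0. *)
Lemma minr_le_harmonic p q : 0 <= p -> 0 <= q ->
  Num.min p q <= p * (q / (p + q)) + q * (p / (p + q)).
Proof.
move=> p0 q0; have [pq0|pq0] := eqVneq (p + q) 0.
  have -> : p = 0 by lra.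
  have -> : q = 0 by lra.
  by rewrite minxx !mul0r addr0.
have pq1 : 0 < p + q by rewrite lt_neqAle eq_sym pq0 addr_ge0.
have -> : p * (q / (p + q)) + q * (p / (p + q)) = (2 * p * q) / (p + q).
  by field.
rewrite ler_pdivlMr//; have [h|h] := leP p q.
  have : 0 <= p * (q - p) by rewrite mulr_ge0 ?subr_ge0.
  by lra.
have : 0 <= q * (p - q) by rewrite mulr_ge0 ?subr_ge0 ?(ltW h).
by lra.
Qed.

(** P is the law of a fine observable z, of which g z is a coarser one, and
    beta is an event seen by z.  On the fibre of g over c let a and b be the
    masses of beta and of its complement.  Each z in beta has mass at most a,
    so that by [gain_term] it gains at least P z * (b / (a + b)), and
    symmetrically outside beta; the fibre thus gains at least the harmonic mean
    of a and b.  The minimum of a and b is the error made when guessing beta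
    from c. *)
Lemma refinement_entropy_gain (I J : finType) (g : J -> I) (beta : pred J)
    (P : J -> R) (p := fun c => \sum_(z | g z == c) P z) :
    (forall z, 0 <= P z) ->
  \sum_c Num.min (\sum_(z | (g z == c) && beta z) P z)
                 (\sum_(z | (g z == c) && ~~ beta z) P z)
  <= - \sum_z P z * ln (P z) + \sum_c p c * ln (p c).
Proof.
move=> P0.
rewrite [X in - X](partition_big g predT)//= addrC.
apply: (@le_trans _ _ (\sum_c (p c * ln (p c) -
  \sum_(z | g z == c) P z * ln (P z)))); last by rewrite sumrB.
apply: ler_sum => c _.
set a := \sum_(z | _ && beta z) P z; set b := \sum_(z | _ && ~~ _) P z.
have pab : p c = a + b by rewrite /p (bigID beta).
have a0 : 0 <= a by exact: sumr_ge0.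
have b0 : 0 <= b by exact: sumr_ge0.
apply: (le_trans (minr_le_harmonic a0 b0)).
rewrite -pab [X in _ <= X * ln _ - _]/p [X in _ <= X - _]mulr_suml -sumrB.
rewrite [X in _ <= X](bigID beta)/= [X in X + _ <= _]mulr_suml [X in _ + X <= _]mulr_suml.
have pz (Q : pred J) z : Q z -> P z <= \sum_(z | Q z) P z.
  by move=> Qz; rewrite (bigD1 z)//= lerDl sumr_ge0.
have key z (e f : R) : p c = e + f -> 0 <= f -> P z <= e ->
    P z * (f / p c) <= P z * ln (p c) - P z * ln (P z).
  move=> pef f0 Pze.
  have Pzp : 0 <= P z <= p c by rewrite P0 pef; lra.
  apply: le_trans (gain_term Pzp).
  have [pc0|pc0] := eqVneq (p c) 0.
    have -> : P z = 0 by have := P0 z; lra.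
    by rewrite !mul0r subrr.
  have pc1 : 0 < p c by rewrite lt_neqAle eq_sym pc0 pef addr_ge0// (le_trans _ Pze).
  rewrite -[X in _ <= X - _]mulr1 -mulrBr ler_wpM2l//.
  by rewrite ler_pdivrMr// mulrBl mul1r divfK// pef; lra.
apply: lerD; apply: ler_sum => z Qz.
- by apply: (key _ a b) => //; exact: pz Qz.
- by apply: (key _ b a) => //; [rewrite addrC|exact: pz Qz].
Qed.

Lemma ln_prod (I : finType) (F : I -> R) :
  (forall i, 0 < F i) -> ln (\prod_i F i) = \sum_i ln (F i).
Proof.
move=> F0.
suff [] : 0 < \prod_i F i /\ ln (\prod_i F i) = \sum_i ln (F i) by [].
elim/big_ind2 : _ => [|a b c d [a0 <-] [c0 <-]|i _]; rewrite ?ln1//.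
by rewrite mulr_gt0// lnM.
Qed.

(** The symmetric channel: the letter b is read as a; with probability theta it
    is replaced by a uniformly chosen letter. *)
Definition noise n (theta : R) (b a : 'I_n) : R :=
  theta / n%:R + (1 - theta) * (a == b)%:R.

Lemma noise_gt0 n theta (b a : 'I_n) : 0 < theta < 1 -> 0 < noise theta b a.
Proof.
move=> /andP[t0 t1]; have n0 : (0 < n)%N by apply: leq_ltn_trans (ltn_ord a).
by rewrite ltr_pwDl ?divr_gt0 ?ltr0n// mulr_ge0// subr_ge0 ltW.
Qed.

Lemma sum_noise n theta (b : 'I_n) : \sum_a noise theta b a = 1.
Proof.
have n0 : (0 < n)%N by apply: leq_ltn_trans (ltn_ord b).
rewrite big_split/= sumr_const card_ord -mulr_sumr (bigD1 b)//= eqxx big1.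
  by rewrite addr0 mulr1 -[_ / _ *+ _]mulr_natr divfK ?subrKC// pnatr_eq0 gt_eqF.
by move=> a /negbTE ->.
Qed.

Lemma ln_noise_le n theta (b a : 'I_n) : 0 < theta < 1 ->
  - ln (noise theta b a) <= - ln (1 - theta) + (a != b)%:R * ln (n%:R / theta).
Proof.
move=> /andP[t0 t1]; have n0 : (0 < n)%N by apply: leq_ltn_trans (ltn_ord a).
have tn : 0 < theta / n%:R by rewrite divr_gt0 ?ltr0n.
rewrite /noise; case: eqVneq => /= [_|_].
  rewrite mulr1 mul0r addr0 lerN2 ler_ln ?posrE ?subr_gt0//; first by rewrite lerDr ltW.
  by rewrite addr_gt0 ?subr_gt0.
rewrite mulr0 addr0 mul1r -[n%:R / _]invf_div lnV ?posrE// lerDr oppr_ge0 ln_le0//.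
by lra.
Qed.

(** The pair z = (x, y) consists of a word x to be estimated and of a table y
    of guesses, y (u i) being the guess for the letter x i.  Gibbs' inequality
    compares the law p of x with the law q of the word obtained by drawing the
    table y uniformly and reading the letters y (u i) through independent noisy
    channels.  Since q x >= n ^ (- #|J|) * \prod_i noise (y (u i)) (x i) for
    every table y, the cost - ln (q x) may be estimated with the true table. *)
Lemma entropy_le_of_guesses (J : finType) n k (u : 'I_k -> J)
    (Z := ({ffun 'I_k -> 'I_n} * {ffun J -> 'I_n})%type) (P : Z -> R) (theta : R)
    (p := fun x => \sum_(z : Z | z.1 == x) P z) :
    (0 < n)%N -> 0 < theta < 1 -> (forall z, 0 <= P z) -> \sum_z P z = 1 ->
  - \sum_x p x * ln (p x) <= #|J|%:R * ln n%:R +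
     \sum_i (- ln (1 - theta) +
             (\sum_(z : Z | z.1 i != z.2 (u i)) P z) * ln (n%:R / theta)).
Proof.
move=> n0 t01 P0 P1; set N : R := (n%:R ^+ #|J|)^-1.
have nR : 0 < n%:R :> R by rewrite ltr0n.
have N0 : 0 < N by rewrite invr_gt0 exprn_gt0.
pose w (x : {ffun 'I_k -> 'I_n}) (y : {ffun J -> 'I_n}) : R :=
  N * \prod_i noise theta (y (u i)) (x i).
have w0 x y : 0 < w x y.
  by rewrite mulr_gt0//; apply: prodr_gt0 => i _; exact: noise_gt0.
pose q x := \sum_y w x y.
have wq x y : w x y <= q x.
  by rewrite /q (bigD1 y)//= lerDl sumr_ge0// => z _; exact: ltW.
have q0 x : 0 < q x by exact: lt_le_trans (w0 x [ffun=> Ordinal n0]) (wq _ _).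
have q1 : \sum_x q x = 1.
  (* Given the table y, the letters are independent. *)
  rewrite exchange_big/=.
  under eq_bigr => y _.
    rewrite -mulr_sumr -(bigA_distr_bigA (fun i a => noise theta (y (u i)) a)).
    rewrite big1 ?mulr1; last by move=> i _; exact: sum_noise.
    over.
  rewrite sumr_const card_ffun card_ord /N -[_^-1 *+ _]mulr_natr natrX mulVf//.
  by rewrite expf_neq0// gt_eqF.
have p1 : \sum_x p x = 1 by rewrite -P1 [RHS](partition_big fst predT).
have p0 x : 0 <= p x by exact: sumr_ge0.
apply: (le_trans (gibbs p0 q0 _)); first by rewrite p1 q1.
have lnw (x : {ffun 'I_k -> 'I_n}) (y : {ffun J -> 'I_n}) :
    - ln (q x) <= #|J|%:R * ln n%:R +
    \sum_i (- ln (1 - theta) + (x i != y (u i))%:R * ln (n%:R / theta)).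
  have /le_trans : - ln (q x) <= - ln (w x y).
    by rewrite lerN2 ler_ln ?posrE.
  apply; rewrite /w lnM ?posrE//; last by apply: prodr_gt0 => i _; exact: noise_gt0.
  rewrite /N lnV ?posrE ?exprn_gt0// lnXn// opprD opprK mulr_natl lerD2l.
  rewrite ln_prod; last by move=> i; exact: noise_gt0.
  by rewrite -sumrN; apply: ler_sum => i _; exact: ln_noise_le.
have -> : - (\sum_x p x * ln (q x)) = \sum_(z : Z) P z * (- ln (q z.1)).
  rewrite -sumrN [RHS](partition_big fst predT)//=; apply: eq_bigr => x _.
  by rewrite -mulrN mulr_suml; apply: eq_bigr => z /eqP ->.
apply: (@le_trans _ _ (\sum_(z : Z) P z * (#|J|%:R * ln n%:R +
    \sum_i (- ln (1 - theta) + (z.1 i != z.2 (u i))%:R * ln (n%:R / theta))))).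
  by apply: ler_sum => z _; rewrite ler_wpM2l.
under eq_bigr do rewrite mulrDr mulr_sumr.
rewrite big_split/= -mulr_suml P1 mul1r lerD2l exchange_big/= ler_sum// => i _.
under eq_bigr do rewrite mulrDr mulrA.
rewrite big_split/= -!mulr_suml P1 mul1r lerD2l.
by rewrite [X in _ <= X * _]big_mkcond/= ; under eq_bigr do rewrite mulr_natr mulrb.
Qed.

End FiniteEntropy.

(** * Finite-valued observables on a probability space *)

Section Observables.
Context d (T : measurableType d) (R : realType) (mu : probability T R).

(** For finite I this is measurability with respect to the discrete
    sigma-algebra, which I need not carry as a structure. *)
Definition observable (I : Type) (f : T -> I) :=
  forall a, measurable (f @^-1` [set a]).

Definition prob (Q : set T) : R := fine (mu Q).

Lemma prob_ge0 Q : 0 <= prob Q. Proof. exact: fine_ge0. Qed.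

Lemma probE Q : measurable Q -> mu Q = (prob Q)%:E.
Proof. by move=> mQ; rewrite fineK// fin_num_measure. Qed.

Lemma le_prob Q Q' : measurable Q -> measurable Q' -> Q `<=` Q' -> prob Q <= prob Q'.
Proof.
by move=> mQ mQ' QQ'; rewrite -lee_fin -!probE// le_measure// inE.
Qed.

Lemma prob_le_setU Q A B : measurable Q -> measurable A -> measurable B ->
  Q `<=` A `|` B -> prob Q <= prob A + prob B.
Proof.
move=> mQ mA mB QAB; apply: (le_trans (le_prob mQ (measurableU _ _ mA mB) QAB)).
by rewrite -lee_fin EFinD -!probE//; [exact: measureU2|exact: measurableU].
Qed.

Section Finite.
Context (I : finType) (f : T -> I) (mf : observable f).

Lemma preimage_pred (Q : pred I) :
  [set x | Q (f x)] = \bigcup_(a in [set` Q]) (f @^-1` [set a]).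
Proof. by apply/seteqP; split=> [x Qx|x [a Qa /= ->]//]; exists (f x). Qed.

Lemma measurable_observable_pred (Q : pred I) : measurable [set x | Q (f x)].
Proof.
by rewrite preimage_pred; apply: fin_bigcup_measurable => // a _; exact: mf.
Qed.

Lemma prob_observable_pred (Q : pred I) :
  prob [set x | Q (f x)] = \sum_(a | Q a) prob (f @^-1` [set a]).
Proof.
apply: EFin_inj; rewrite -probE; last exact: measurable_observable_pred.
rewrite preimage_pred measure_fin_bigcup//; last first.
  apply/trivIsetP => a b _ _ ab; apply/seteqP; split=> // x [/= -> /eqP].
  by rewrite (negbTE ab).
rewrite -(@bigfs _ _ _ _ (index_enum I) Q)/= ?index_enum_uniq//; last first.
  by move=> i _; rewrite mem_index_enum.
by rewrite -sumEFin; apply: eq_bigr => a _; rewrite probE.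
Qed.

Lemma sum_prob_observable : \sum_a prob (f @^-1` [set a]) = 1.
Proof.
rewrite -(prob_observable_pred predT) /prob (_ : [set x | _] = setT).
  by rewrite probability_setT.
by apply/seteqP; split.
Qed.

Lemma observable_comp (J : Type) (g : I -> J) : observable (g \o f).
Proof.
move=> b.
have -> : (g \o f) @^-1` [set b] = [set x | `[< g (f x) = b >]].
  by apply/seteqP; split => x /= /asboolP.
exact: (measurable_observable_pred (fun a => `[< g a = b >])).
Qed.

Lemma prob_observable_comp (J : eqType) (g : I -> J) b :
  prob ((g \o f) @^-1` [set b]) = \sum_(a | g a == b) prob (f @^-1` [set a]).
Proof.
rewrite -(prob_observable_pred (fun a => g a == b)); congr prob.
by apply/seteqP; split => x /= /eqP.
Qed.

End Finite.

Lemma observable_pair (I J : Type) (f : T -> I) (g : T -> J) :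
  observable f -> observable g -> observable (fun x => (f x, g x)).
Proof.
move=> mf mg [a b].
have -> : (fun x => (f x, g x)) @^-1` [set (a, b)] =
    f @^-1` [set a] `&` g @^-1` [set b].
  by apply/seteqP; split => [x /= [-> ->]|x /= [-> ->]].
exact: measurableI.
Qed.

Lemma observable_ffun (K I : finType) (f : K -> T -> I) :
  (forall k, observable (f k)) -> observable (fun x => [ffun k => f k x]).
Proof.
move=> mf a.
have -> : (fun x => [ffun k => f k x]) @^-1` [set a] =
    \bigcap_(k in [set: K]) (f k @^-1` [set a k]).
  apply/seteqP; split => [x /= <- k _/=|x h]; first by rewrite ffunE.
  by apply/ffunP => k; rewrite ffunE; exact: h.
by apply: fin_bigcap_measurable => // k _; exact: mf.
Qed.

Definition disagree (I : Type) (f g : T -> I) := prob [set x | f x <> g x].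

Lemma measurable_disagree (I : finType) (f g : T -> I) :
  observable f -> observable g -> measurable [set x | f x <> g x].
Proof.
move=> mf mg; rewrite (_ : [set x | _] = [set x | f x != g x]).
  exact: (measurable_observable_pred (observable_pair mf mg) (fun z => z.1 != z.2)).
by apply/seteqP; split => x /= /eqP.
Qed.

Lemma disagreexx (I : Type) (f : T -> I) : disagree f f = 0.
Proof.
rewrite /disagree (_ : [set x | _] = set0) /prob ?measure0//.
by apply/seteqP; split => x //= /(_ erefl).
Qed.

Lemma disagreeC (I : Type) (f g : T -> I) : disagree f g = disagree g f.
Proof. by congr prob; apply/seteqP; split => x /= h /esym/h. Qed.

Lemma disagree_triangle (I : finType) (f g h : T -> I) :
  observable f -> observable g -> observable h ->
  disagree f h <= disagree f g + disagree g h.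
Proof.
move=> mf mg mh; apply: prob_le_setU; [exact: measurable_disagree..|].
by move=> x /= fh; have [<-|/eqP] := eqVneq (f x) (g x); [right|left].
Qed.

(** If f x and g x differ, then the indicators of the cell of f x already
    differ. *)
Lemma disagree_le_sum (I : finType) (f g : T -> I) :
    observable f -> observable g ->
  disagree f g <= \sum_a disagree (fun x => f x == a) (fun x => g x == a).
Proof.
move=> mf mg; have mp := observable_pair mf mg.
pose P z := prob ((fun x => (f x, g x)) @^-1` [set z]).
have P0 z : 0 <= P z by exact: prob_ge0.
have -> : disagree f g = \sum_(z : I * I | z.1 != z.2) P z.
  rewrite -(prob_observable_pred mp (fun z => z.1 != z.2)).
  by congr prob; apply/seteqP; split => x /= /eqP.
have E a : disagree (fun x => f x == a) (fun x => g x == a) =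
    \sum_(z : I * I | (z.1 == a) != (z.2 == a)) P z.
  rewrite -(prob_observable_pred mp (fun z => (z.1 == a) != (z.2 == a))).
  by congr prob; apply/seteqP; split => x /= /eqP.
rewrite (eq_bigr _ (fun a _ => E a)).
under eq_bigr do rewrite big_mkcond.
rewrite exchange_big/= big_mkcond; apply: ler_sum => z _.
rewrite -big_mkcond; case: ifPn => zz; last exact: sumr_ge0.
rewrite (bigD1 z.1)/= ?lerDl ?sumr_ge0//.
by rewrite eqxx [z.2 == _]eq_sym (negbTE zz).
Qed.

Lemma observable_in (A : set T) : measurable A -> observable (fun x => x \in A).
Proof.
move=> mA [].
  rewrite (_ : _ @^-1` _ = A)//; apply/seteqP; split => x /=; first exact: set_mem.
  exact: mem_set.
rewrite (_ : _ @^-1` _ = ~` A); first exact: measurableC.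
apply/seteqP; split => x /=; first by move=> xA Ax; rewrite (mem_set Ax) in xA.
by move=> nA; apply/negbTE/negP => /set_mem.
Qed.

(** The limit is the limit inferior B of the sequence: a point at which A n and
    B differ changes side at some step after n, so the errors from n on add
    up. *)
Lemma fast_Cauchy_sets (A : nat -> set T) : (forall n, measurable (A n)) ->
    (forall n, disagree (fun x => x \in A n) (fun x => x \in A n.+1) <=
               4 / 2 ^+ n) ->
  exists2 B, measurable B & forall n,
    disagree (fun x => x \in A n) (fun x => x \in B) <= 8 / 2 ^+ n.
Proof.
move=> mA cA; pose B := \bigcup_n \bigcap_k A (n + k)%N.
have mB : measurable B.
  by apply: bigcupT_measurable => n; apply: bigcapT_measurable => k; exact: mA.
exists B => // n.
pose E k := [set x | (x \in A (n + k)%N) <> (x \in A (n + k).+1)].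
have mE k : measurable (E k) by apply: measurable_disagree; exact: observable_in.
have mD : measurable [set x | (x \in A n) <> (x \in B)].
  by apply: measurable_disagree; exact: observable_in.
have sub : [set x | (x \in A n) <> (x \in B)] `<=` \bigcup_k E k.
  move=> x /= nAB; apply: contrapT => nE; apply: nAB.
  have cst k : (x \in A (n + k)%N) = (x \in A n).
    elim: k => [|k <-]; first by rewrite addn0.
    rewrite addnS; apply/esym; apply: contrapT => h; apply: nE.
    by exists k.
  apply/idP/idP; rewrite !inE => xA.
    by exists n => // k _ /=; have := cst k; rewrite (mem_set xA) => /set_mem.
  have [m _ xm] := xA; have := xm n I; rewrite /= addnC => h.
  by have := cst m; rewrite (mem_set h) => /esym/set_mem.
rewrite -lee_fin /disagree -probE//.
have le1 := measure_sigma_subadditive mu mE mD sub.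
apply: (le_trans le1).
(* The tail of the errors: 4 / 2^(n+k) = (8 / 2^n) / 2^(k+1). *)
apply: le_trans (epsilon_trick0 xpredT (_ : 0 <= 8 / 2 ^+ n)); last first.
  by rewrite divr_ge0// exprn_ge0.
apply: lee_nneseries => // k _; apply: (@le_trans _ _ (prob (E k))%:E).
  by rewrite -probE.
rewrite lee_fin.
apply: (le_trans (cA _)).
rewrite natrX exprD exprS le_eqVlt; apply/orP; left; apply/eqP; field.
by rewrite !expf_neq0.
Qed.

Definition obs_entropy (I : finType) (f : T -> I) : R :=
  - \sum_a prob (f @^-1` [set a]) * ln (prob (f @^-1` [set a])).

Lemma prob_le1 Q : measurable Q -> prob Q <= 1.
Proof. by move=> mQ; rewrite -lee_fin -probE// probability_le1. Qed.

Lemma obs_entropy_ge0 (I : finType) (f : T -> I) :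
  observable f -> 0 <= obs_entropy f.
Proof.
move=> mf; rewrite /obs_entropy -sumrN sumr_ge0// => a _.
by rewrite -mulrN mulr_ge0 ?prob_ge0// oppr_ge0 ln_le0// prob_le1.
Qed.

(** The best guess of the event beta o f from g o f is by majority: c is put
    in S when beta is at least as likely as its complement on the cell of c.
    Its error is the sum over c of the smaller of the two masses, which
    [refinement_entropy_gain] bounds.  When f refines g o f by the event beta
    alone, this says that refining by a badly approximable event costs
    entropy. *)
Lemma exists_coarse_guess (I J : finType) (f : T -> J) (g : J -> I)
    (beta : pred J) : observable f ->
  exists S : {set I},
    disagree (beta \o f) (fun x => g (f x) \in S) <=
    obs_entropy f - obs_entropy (g \o f).
Proof.
move=> mf; pose P a := prob (f @^-1` [set a]).
pose a c := \sum_(z | (g z == c) && beta z) P z.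
pose b c := \sum_(z | (g z == c) && ~~ beta z) P z.
exists [set c | b c <= a c]%SET.
have -> : disagree (beta \o f) (fun x => g (f x) \in [set c | b c <= a c]%SET) =
    \sum_c Num.min (a c) (b c).
  have -> : disagree (beta \o f) (fun x => g (f x) \in [set c | b c <= a c]%SET)
     = prob [set x | [pred z | beta z != (b (g z) <= a (g z))] (f x)].
    by congr prob; apply/seteqP; split => x /=; rewrite inE => /eqP.
  rewrite prob_observable_pred// (partition_big g predT)//=.
  apply: eq_bigr => c _; rewrite minEge; case: ifPn => h.
    by apply: eq_bigl => z; rewrite andbC; case: eqP => //= ->; rewrite h eqb_id.
  apply: eq_bigl => z; rewrite andbC; case: eqP => //= ->.
  by rewrite (negbTE h) eqbF_neg negbK.
have P0 z : 0 <= P z by exact: prob_ge0.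
apply: (le_trans (refinement_entropy_gain g beta P0)).
rewrite /obs_entropy opprK lerD2l; apply: ler_sum => c _.
by rewrite prob_observable_comp.
Qed.

(** The observables g j are the possible guesses, g (u i) being the one made
    for f i. *)
Lemma obs_entropy_le_of_guesses (J : finType) n k (u : 'I_k -> J)
    (f : 'I_k -> T -> 'I_n) (g : J -> T -> 'I_n) (theta delta : R) :
    (0 < n)%N -> 0 < theta < 1 ->
    (forall i, observable (f i)) -> (forall j, observable (g j)) ->
    (forall i, disagree (f i) (g (u i)) <= delta) ->
  obs_entropy (fun x => [ffun i => f i x]) <= #|J|%:R * ln n%:R +
     k%:R * (- ln (1 - theta) + delta * ln (n%:R / theta)).
Proof.
move=> n0 t01 mf mg fg.
pose Z := ({ffun 'I_k -> 'I_n} * {ffun J -> 'I_n})%type.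
pose z x : Z := ([ffun i => f i x], [ffun j => g j x]).
have mz : observable z by apply: observable_pair; exact: observable_ffun.
pose P a := prob (z @^-1` [set a]).
have P0 a : 0 <= P a by exact: prob_ge0.
have P1 : \sum_a P a = 1 by exact: sum_prob_observable.
have -> : obs_entropy (fun x => [ffun i => f i x]) =
    - \sum_x (\sum_(a : Z | a.1 == x) P a) * ln (\sum_(a : Z | a.1 == x) P a).
  congr (- _); apply: eq_bigr => x _.
  by rewrite -(prob_observable_comp mz (fst : Z -> _)).
apply: (le_trans (entropy_le_of_guesses u n0 t01 P0 P1)).
rewrite lerD2l; set c := _ + delta * _.
have -> : k%:R * c = \sum_(i < k) c by rewrite sumr_const card_ord mulr_natl.
rewrite /c.
apply: ler_sum => i _; rewrite lerD2l ler_wpM2r//.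
  rewrite ln_ge0// ler_pdivlMr ?mul1r; last by case/andP: t01.
  by apply: (@le_trans _ _ 1); [case/andP: t01 => _ /ltW|rewrite ler1n].
apply: le_trans (fg i).
rewrite -(prob_observable_pred mz (fun a : Z => a.1 i != a.2 (u i))).
rewrite (_ : [set x | _] = [set x | f i x <> g (u i) x])//.
by apply/seteqP; split => x /=; rewrite !ffunE => /eqP.
Qed.

End Observables.

(** * Precompactness in metric spaces *)

Section Precompact.
Context {R : realType} (M : metricType R) (W : choiceType) (F : W -> M) (L : set W).

(** Total boundedness of F @` L, through classifications instead of nets:
    these can be paired, translated and composed. *)
Definition totally_bounded_family := forall e : R, 0 < e ->
  exists (J : finType) (c : W -> J), forall w u, L w -> L u -> c w = c u ->
    mdist (F w) (F u) < e.

(** Near-coverings indexed by finite lists of points, ordered by inclusion,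
    turn compactness into a finite list of balls covering the closure; a
    parameter is classified by the first ball of the list that contains its
    image. *)
Lemma totally_bounded_of_compact :
  compact (closure (F @` L)) -> totally_bounded_family.
Proof.
move=> /compact_near_coveringP cpt e e0.
have e2 : 0 < e / 2 by exact: divr_gt0.
pose lists : set_system (seq M) :=
  filter_from setT (fun l0 : seq M => [set l : seq M | {subset l0 <= l}]).
have FF : Filter lists.
  apply: filter_from_filter; first by exists [::].
  move=> l1 l2 _ _; exists (l1 ++ l2) => //= l sl.
  by split => p pl; apply: sl; rewrite mem_cat pl ?orbT.
have [|l0 _ /(_ l0)/= lP] := cpt _ lists
    (fun (l : seq M) p => exists2 q, q \in l & ball q (e / 2) p) FF.
  move=> p _; exists (ball p (e / 2), [set l : seq M | {subset [:: p] <= l}]) => /=.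
    by split; [exact: nbhsx_ballx|exists [:: p]].
  by move=> [q l] /= [pq pl]; exists p => //; apply: pl; rewrite mem_head.
pose near_point w (q : M) := `[< ball q (e / 2) (F w) >].
(* The value size l0, for no ball found, is not reached on L. *)
exists 'I_(size l0).+1, (fun w => inord (find (near_point w) l0)).
have fnd w : L w -> (find (near_point w) l0 < size l0)%N.
  move=> Lw; rewrite -has_find; apply/hasP.
  have Fw : closure (F @` L) (F w) by apply: subset_closure; exists w.
  have [//|q ql qw] := lP _ (F w) Fw.
  by exists q => //; exact/asboolP.
have fndP w : L w -> ball (nth (F w) l0 (find (near_point w) l0)) (e / 2) (F w).
  move=> Lw; apply/asboolP.
  by apply: (nth_find (F w) (a := near_point w)); rewrite has_find fnd.
move=> w u Lw Lu /(congr1 (@nat_of_ord _)); rewrite !inordK ?ltnS; [|exact/ltnW/fnd..].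
move=> wu; have := fndP _ Lw; have := fndP _ Lu.
rewrite -wu (set_nth_default (F w)) ?fnd//.
move: (nth _ _ _) => q; rewrite !ballEmdist/= => qu qw.
apply: (le_lt_trans (metric_triangle _ q _)).
by rewrite metric_sym [e]splitr ltrD.
Qed.

(** An ultrafilter on the closure contains, for each n, a ball of radius 2^-n
    centred in the family: otherwise it would contain the complements of
    finitely many such balls, which cover the closure.  Successive balls meet,
    so their centres form a fast Cauchy sequence, and the ultrafilter converges
    to its limit.  Completeness is thus asked only of fast Cauchy sequences of
    the family. *)
Lemma compact_of_totally_bounded : totally_bounded_family ->
    (forall w : nat -> W, (forall n, L (w n)) ->
      (forall n, mdist (F (w n)) (F (w n.+1)) < 2 / 2 ^+ n) ->
      exists l, forall e, 0 < e -> \forall n \near \oo, mdist (F (w n)) l < e) ->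
  compact (closure (F @` L)).
Proof.
move=> tb complete; rewrite compact_ultra => U UU UF.
have FU : Filter U by apply: ultra_proper.
have small r : 0 < r -> exists w, L w /\ U (ball (F w) r).
  move=> r0; apply: contrapT => no.
  have [J [c cP]] := tb _ (divr_gt0 r0 (ltr0n R 2)).
  have [w0 Lw0] : exists w, L w.
    have [p Fp] := filter_ex UF.
    by have [_ [[w Lw _] _]] := Fp _ filterT; exists w.
  pose rep j := xget w0 [set w | L w /\ c w = j].
  have : \forall p \near U, forall j, L (rep j) -> ~ ball (F (rep j)) r p.
    apply: filter_forall => j; have [Lj|nLj] := pselect (L (rep j)); last exact: nearW.
    have [Uj|Uj] := in_ultra_setVsetC (ball (F (rep j)) r) UU.
      by exfalso; apply: no; exists (rep j).
    by apply: filterS Uj => p.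
  move=> /(filterI UF) /filter_ex[p [clp far]].
  have [_ [[w Lw <-] pw]] := clp _ (nbhsx_ballx p _ (divr_gt0 r0 (ltr0n R 2))).
  have [Lr cr] : [set v | L v /\ c v = c w] (rep (c w)).
    by apply: xgetPex; exists w.
  apply: (far (c w) Lr); rewrite [r]splitr; apply: ball_triangle (ball_sym pw).
  by rewrite ballEmdist /=; exact: cP.
have /choice[w wP] n : exists w, L w /\ U (ball (F w) (1 / 2 ^+ n)).
  by apply: small; rewrite divr_gt0// exprn_gt0.
have close n p : ball (F (w n)) (1 / 2 ^+ n) p -> mdist (F (w n)) p < 1 / 2 ^+ n.
  by rewrite ballEmdist.
have [n|n|l lP] := complete w; first by have [] := wP n.
  have [_ Un] := wP n; have [_ Un1] := wP n.+1.
  have [p [pn pn1]] := filter_ex (filterI Un Un1).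
  apply: (le_lt_trans (metric_triangle _ p _)).
  have -> : 2 / 2 ^+ n = 1 / 2 ^+ n + 1 / 2 ^+ n :> R by rewrite -mulrDl.
  rewrite ltrD// ?close// metric_sym (lt_le_trans (close _ _ pn1))//.
  by rewrite ler_pM2l// lef_pV2 ?posrE ?exprn_gt0// ler_eXn2l// ltr1n.
have Ul : U --> l.
  apply/metricType_numDomainType.fcvgrPdist_lt => e e0.
  have e2 : 0 < e / 2 by exact: divr_gt0.
  have pow_cvg : \forall n \near \oo, 1 / 2 ^+ n < e / 2.
    have := @cvg_geometric _ 1 (2^-1 : R).
    rewrite ger0_norm ?invr_ge0// invf_lt1// ltr1n => /(_ isT)/cvgrPdist_lt/(_ _ e2).
    apply: filterS => n; rewrite sub0r normrN /geometric /= mul1r exprVn div1r.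
    by rewrite ger0_norm ?invr_ge0 ?exprn_ge0.
  have [n [n1 n2]] := filter_ex (filterI (lP _ e2) pow_cvg).
  have [_] := wP n; apply: filterS => p /close pn.
  rewrite metric_sym (le_lt_trans (metric_triangle _ (F (w n)) _))//.
  by rewrite [e]splitr ltrD// metric_sym (lt_trans pn).
exists l; split => // A /nbhs_interior/Ul UA.
by have [p [Ap clp]] := filter_ex (filterI UA UF); exact: clp.
Qed.

End Precompact.

(** * Compact orbit closures and almost periodic observables *)

Section L2.
Context {R : realType} (X : Z2MPS R).
Local Notation mu := (law X).
Local Notation T := (act X).
Local Notation L2 := (LspaceType mu (lee1n 2)).

(** Both sides are the integral of the square of \1_A - \1_B, which only takes
    the values 0, 1 and -1. *)
Lemma mdist_indic (f g : L2) (A B : set (borel X)) :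
    measurable A -> measurable B ->
    Lspace_fun f = \1_A %[ae mu] -> Lspace_fun g = \1_B %[ae mu] ->
  mdist f g ^+ 2 = disagree mu (fun x : borel X => x \in A) (fun x => x \in B).
Proof.
move=> mA mB fA gB; apply: EFin_inj.
have mD : measurable [set x : borel X | (x \in A) <> (x \in B)].
  by apply: measurable_disagree; exact: observable_in.
rewrite /disagree -probE// -(powR_mulrn 2 (mdist_ge0 f g)) -poweR_EFin.
have -> : ((mdist f g)%:E = 'N[mu]_2%:E [EFin \o (\1_A \- \1_B : borel X -> R)%R])%E.
  rewrite -[LHS]/((Lspace_dist f g)%:E) Lspace_distE; apply: ae_eq_Lnorm.
  - by apply: measurable_funB; exact: measurable_Lspace_fun.
  - by apply: measurable_funB; exact: measurable_indic.
  - by move: fA gB; apply: filterS2 => x fx gx xT /=; rewrite fx ?gx.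
rewrite poweR_Lnorm//.
transitivity (\int[mu]_x (\1_[set x : borel X | (x \in A) <> (x \in B)] x)%:E)%E.
  apply: eq_integral => x _ /=; rewrite !indicE; congr EFin.
  have [AB|/eqP AB] := eqVneq (x \in A) (x \in B).
    by rewrite AB subrr normr0 powR0 ?pnatr_eq0// memNset//= AB.
  rewrite (mem_set (AB : [set x | (x \in A) <> (x \in B)] x)).
  by move: AB; case: (x \in A); case: (x \in B) => //= _;
    rewrite ?subr0 ?sub0r ?normrN normr1 powR1.
by rewrite integral_indic// setIT.
Qed.

Lemma measurable_preimage_act w (B : set (borel X)) :
  measurable B -> measurable (T w @^-1` B : set (borel X)).
Proof. by move=> mB; rewrite -[X in measurable X]setTI; exact: measurable_act. Qed.

Lemma disagree_act w (I : finType) (f g : borel X -> I) :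
    observable f -> observable g ->
  disagree mu (f \o T w) (g \o T w) = disagree mu f g.
Proof.
move=> mf mg; rewrite /disagree /prob.
by rewrite -[in RHS](act_invariant X w _ (measurable_disagree mf mg)).
Qed.

Lemma observable_act w I (f : borel X -> I) :
  observable f -> observable (f \o T w : borel X -> I).
Proof.
by move=> mf a; exact: (measurable_preimage_act w (mf a)).
Qed.

Definition finitely_many_translates (L : set (int * int)) (I : Type)
    (f : borel X -> I) (e : R) :=
  exists (J : finType) (c : int * int -> J), forall w u, L w -> L u ->
    c w = c u -> disagree mu (f \o T w) (f \o T u) < e.

Definition almost_periodic_along (L : set (int * int)) (I : Type)
    (f : borel X -> I) :=
  forall e : R, 0 < e -> finitely_many_translates L f e.

Lemma preimage_in w (B : set (borel X)) :
  (fun x : borel X => x \in T w @^-1` B) = (fun x => x \in B) \o T w.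
Proof. by apply/funext => x /=; apply/idP/idP => /set_mem/= h; exact: mem_set. Qed.

Lemma mdist_koopman (B : set (borel X)) (mB : measurable B) w u :
  mdist (koopman w (indicL2 mB)) (koopman u (indicL2 mB)) ^+ 2 =
  disagree mu ((fun x => x \in B) \o T w) ((fun x => x \in B) \o T u).
Proof.
rewrite -!preimage_in.
by apply: mdist_indic; [exact: measurable_preimage_act..|
  exact: koopman_indicE|exact: koopman_indicE].
Qed.

(** Total boundedness for the L2 distance is almost periodicity, at scale e^2
    instead of e.  The completeness needed for compactness is that of the
    measure algebra: a limit of translates of B is again the class of a set. *)
Lemma compact_orbit_iff (L : set (int * int)) (B : set (borel X)) (mB : measurable B) :
  compact (closure [set koopman w (indicL2 mB) | w in L]) <->
  almost_periodic_along L (fun x => x \in B).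
Proof.
split=> [/totally_bounded_of_compact tb e e0|ap].
  have [|J [c cP]] := tb (Num.sqrt e); first by rewrite sqrtr_gt0.
  exists J, c => w u Lw Lu cwu; rewrite -mdist_koopman -(sqr_sqrtr (ltW e0)).
  by rewrite ltr_pXn2r ?nnegrE ?sqrtr_ge0 ?mdist_ge0//; exact: cP.
apply: compact_of_totally_bounded.
  move=> e e0; have [|J [c cP]] := ap (e ^+ 2); first by rewrite exprn_gt0.
  exists J, c => w u Lw Lu /cP; rewrite -mdist_koopman => /(_ Lw Lu).
  by rewrite ltr_pXn2r ?nnegrE ?mdist_ge0 ?ltW.
move=> w Lw dw.
have mT n := measurable_preimage_act (w n) mB.
have [n|C mC CP] := fast_Cauchy_sets mT (mu := mu).
  rewrite !preimage_in -mdist_koopman.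
  apply: (@le_trans _ _ ((2 / 2 ^+ n) ^+ 2)).
    by rewrite ler_pXn2r ?nnegrE ?mdist_ge0 ?divr_ge0 ?exprn_ge0// ltW.
  have p0 : 0 < (2 ^+ n)^-1 :> R by rewrite invr_gt0 exprn_gt0.
  have p1 : (2 ^+ n)^-1 <= 1 :> R by rewrite invf_le1 ?exprn_gt0// exprn_ege1// ler1n.
  by rewrite expr2; nra.
exists (indicL2 mC) => e e0.
have e2 : 0 < e ^+ 2 / 8 by rewrite divr_gt0 ?exprn_gt0.
have := @cvg_geometric _ 1 (2^-1 : R).
rewrite ger0_norm ?invr_ge0// invf_lt1// ltr1n => /(_ isT)/cvgrPdist_lt/(_ _ e2).
apply: filterS => n; rewrite sub0r normrN /geometric /= mul1r exprVn.
rewrite ger0_norm ?invr_ge0 ?exprn_ge0// => ne.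
have : mdist (koopman (w n) (indicL2 mB)) (indicL2 mC) ^+ 2 < e ^+ 2.
  rewrite (mdist_indic (mT n) mC); [|exact: koopman_indicE|exact: Lspace_classE].
  by apply: (le_lt_trans (CP n)); rewrite -ltr_pdivlMl// mulrC.
by rewrite ltr_pXn2r ?nnegrE ?mdist_ge0 ?ltW.
Qed.

End L2.

(** * Almost periodicity along strips *)

Section Limsup.
Context {R : realType}.

Lemma limn_esup_le (u : (\bar R)^nat) l :
  (\forall n \near \oo, (u n <= l)%E) -> (limn_esup u <= l)%E.
Proof.
move=> ul; apply: (@le_trans _ _ (ereal_sup (u @` [set n | (u n <= l)%E]))).
  by apply: ereal_inf_lbound; exists [set n | (u n <= l)%E].
by apply: ge_ereal_sup => _ [n /= un <-].
Qed.

Lemma limn_esup_ge (u : (\bar R)^nat) l :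
  (\forall n \near \oo, (l <= u n)%E) -> (l <= limn_esup u)%E.
Proof.
move=> lu; apply: le_ereal_inf_tmp => _ [V FV <-].
have [n [Vn un]] := filter_ex (filterI FV lu).
by apply: (le_trans un); apply: ereal_sup_ubound; exists n.
Qed.

End Limsup.

Section Main.
Context {R : realType} (X : Z2MPS R).
Local Notation mu := (law X).
Local Notation T := (act X).

Lemma actDE w u x : T (w + u) x = T w (T u x).
Proof. by rewrite -actD. Qed.

(** Cut the strip of width b' into finitely many parallel strips of width b/2
    and choose a vector r in each that contains one.  A vector w in the same
    thin strip as r has w - r in the strip of width b, and f o T^w is
    (f o T^(w - r)) o T^r; as T^r preserves the measure, classifying w by its
    thin strip and by the class of w - r is enough. *)
Lemma almost_periodic_along_strip (I : finType) (f : borel X -> I) (beta b b' : R) :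
  0 < b -> observable f ->
  almost_periodic_along (strip beta b) f -> almost_periodic_along (strip beta b') f.
Proof.
move=> b0 mf ap e e0; have [J [c cP]] := ap e e0.
(* The height of w above the line, in units of b/2. *)
pose t (w : int * int) : R := (w.2%:~R - beta * w.1%:~R) / (b / 2).
pose m := Num.bound `|b' / b|.
have tm w : strip beta b' w -> - m%:R < t w < m%:R.
  move=> /andP[h1 h2]; rewrite -ltr_norml.
  apply: le_lt_trans (archi_boundP (normr_ge0 (b' / b))).
  have -> : b' / b = (b' / 2) / (b / 2) by field; rewrite gt_eqF.
  rewrite /t [leLHS]normrM [leRHS]normrM ler_wpM2r//.
  by rewrite (@le_trans _ _ (b' / 2)) ?ler_norm// ler_norml; lra.
pose cell w : 'I_(m + m).+1 := inord (Num.truncn (t w + m%:R)).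
have cellP w : strip beta b' w -> (cell w)%:R <= t w + m%:R < (cell w).+1%:R.
  move=> /tm tw; have tw0 : 0 <= t w + m%:R by lra.
  have /andP[h1 h2] := truncn_itv tw0.
  rewrite /cell inordK ?h1// ltnS -(ler_nat R) natrD; lra.
pose rep k := xget (0, 0) [set u | strip beta b' u /\ cell u = k].
have repP w : strip beta b' w -> strip beta b (w - rep (cell w)).
  move=> sw; have [sr cr] : [set u | strip beta b' u /\ cell u = cell w] (rep (cell w)).
    by apply: xgetPex; exists w.
  move: (rep _) sr cr => r sr cr.
  have := cellP _ sw; have := cellP _ sr; rewrite cr -!natr1 => h1 h2.
  have : -1 < t w - t r < 1 by lra.
  rewrite /t -mulrBl ltr_pdivlMr ?ltr_pdivrMr ?divr_gt0//.
  by rewrite /strip /= !rmorphB /= !mulrBr; lra.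
exists ('I_(m + m).+1 * J)%type, (fun w => (cell w, c (w - rep (cell w)))).
move=> w u sw su [cwu cc]; move: cc (repP _ su) (repP _ sw).
rewrite -cwu; set r := rep _ => cc sur swr.
have shift v : f \o T v = (f \o T (v - r)) \o T r.
  by apply/funext => x /=; rewrite -actDE subrK.
rewrite (shift w) (shift u) disagree_act; [exact: cP|exact: observable_act..].
Qed.

(** Classify a vector by its classes for all the cells at once. *)
Lemma almost_periodic_of_cells (L : set (int * int)) (I : finType)
    (f : borel X -> I) : observable f ->
  (forall a, almost_periodic_along L (fun x => f x == a)) ->
  almost_periodic_along L f.
Proof.
move=> mf ap e e0.
(* The successor makes the sum of the errors strictly smaller than e. *)
have e1 : 0 < e / (#|I|.+1)%:R by rewrite divr_gt0// ltr0n.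
pose J a := projT1 (cid (ap a _ e1)).
pose c a := projT1 (cid (projT2 (cid (ap a _ e1)))).
have cP a := projT2 (cid (projT2 (cid (ap a _ e1)))).
exists {dffun forall a, J a}, (fun w => [ffun a => c a w] : {dffun forall a, J a}).
move=> w u Lw Lu /ffunP cwu.
have := disagree_le_sum mu (observable_act w mf) (observable_act u mf).
move=> /le_lt_trans; apply.
apply: (@le_lt_trans _ _ (\sum_(a : I) e / (#|I|.+1)%:R)).
  apply: ler_sum => a _; apply/ltW/cP => //.
  by have := cwu a; rewrite !ffunE.
rewrite sumr_const -[_ / _ *+ _]mulr_natr mulrAC -mulrA.
rewrite gtr_pMr// ltr_pdivrMr ?mul1r ?ltr0n//.
by rewrite ltr_nat.
Qed.

(** * Itineraries and sequence entropy *)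

Definition itinerary (I : finType) (f : borel X -> I) (s : nat -> int * int) k
    (x : borel X) : {ffun 'I_k -> I} := [ffun i : 'I_k => f (T (s i) x)].

Lemma observable_itinerary (I : finType) (f : borel X -> I) s k :
  observable f -> observable (itinerary f s k).
Proof. by move=> mf; apply: observable_ffun => i; exact: (observable_act (s i) mf). Qed.

Lemma entropy_join_pullback n (f : borel X -> 'I_n) s k :
  entropy (@join_pullback R X n (fun i => f @^-1` [set i]) s k) =
  obs_entropy mu (itinerary f s k).
Proof.
rewrite /entropy /obs_entropy; congr (- _); apply: eq_bigr => j _.
suff -> : join_pullback (fun i => f @^-1` [set i]) s j =
    itinerary f s k @^-1` [set j] by [].
apply/seteqP; split => [x h|x /= <- i _/=]; last by rewrite ffunE.
by apply/ffunP => i; rewrite ffunE; exact: h.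
Qed.

Lemma index_of_partition n (A : 'I_n -> set (borel X)) :
  measurable_partition A ->
  exists2 f : borel X -> 'I_n, observable f & A = (fun i => f @^-1` [set i]).
Proof.
move=> [mA [cA tA _]].
have /choice[f fP] x : exists i, A i x.
  by have : [set: borel X] x by []; rewrite -cA => -[i _ Aix]; exists i.
have AE : A = (fun i => f @^-1` [set i]).
  apply/funext => i; apply/seteqP; split => [x Aix|x /= <-//].
  by apply: tA => //; exists x.
by exists f => // i; have := mA i; rewrite AE.
Qed.

Lemma measurable_partition_index n (f : borel X -> 'I_n) :
  observable f -> (forall i, exists x, f x = i) ->
  measurable_partition (fun i => f @^-1` [set i]).
Proof.
move=> mf fs; split=> //; split; first by apply/seteqP; split => // x _; exists (f x).
- by apply/trivIsetP => a b _ _ /eqP ab; apply/seteqP; split=> // x [/= -> /ab].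
- by move=> i _; have [x] := fs i; exists x.
Qed.

(** The guesses are the translates of f by one representative of each class.
    The constants split the entropy rate in two: theta makes - ln (1 - theta)
    equal to e/4, and then delta makes the cost of the wrong guesses at most
    e/4.  The remaining term is independent of k and disappears in the
    average. *)
Lemma seq_entropy_of_eq0 n (f : borel X -> 'I_n) (L : set (int * int)) s :
    observable f -> almost_periodic_along L f -> (forall i, L (s i)) ->
  seq_entropy_of s (fun i => f @^-1` [set i]) = 0%E.
Proof.
move=> mf ap Ls; apply/eqP; rewrite eq_le; apply/andP; split; last first.
  apply: limn_esup_ge; apply: nearW => k; rewrite lee_fin entropy_join_pullback.
  by rewrite mulr_ge0 ?invr_ge0// obs_entropy_ge0//; exact: observable_itinerary.
apply/lee_addgt0Pr => e e0; rewrite add0e.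
have n0 : (0 < n)%N by apply: leq_ltn_trans (ltn_ord (f point)).
pose theta : R := 1 - expR (- (e / 4)).
have t01 : 0 < theta < 1.
  by rewrite subr_gt0 expR_lt1 oppr_lt0 divr_gt0//= gtrBl expR_gt0.
have lnt : ln (1 - theta) = - (e / 4) by rewrite /theta opprB subrKC expRK.
have [t0 t1] := andP t01.
have lnn : 0 <= ln (n%:R / theta).
  by rewrite ln_ge0// ler_pdivlMr// mul1r (le_trans (ltW t1))// ler1n.
pose delta := e / 4 / (ln (n%:R / theta) + 1).
have d0 : 0 < delta by rewrite !divr_gt0// ltr_wpDl.
have dl : delta * ln (n%:R / theta) <= e / 4.
  by rewrite /delta mulrAC ler_pdivrMr ?ltr_wpDl// ler_wpM2l ?lerDl// divr_ge0// ltW.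
have [J [c cP]] := ap _ d0.
pose rep j := xget (s 0) [set w | L w /\ c w = j].
pose C := #|J|%:R * ln n%:R : R.
have C0 : 0 <= C by rewrite mulr_ge0// ln_ge0// ler1n.
have bound k : obs_entropy mu (itinerary f s k) <= C + k%:R * (e / 2).
  have /le_trans : obs_entropy mu (itinerary f s k) <=
      C + k%:R * (- ln (1 - theta) + delta * ln (n%:R / theta)).
    apply: (@obs_entropy_le_of_guesses _ _ _ mu J n k (fun i => c (s i))
      (fun i => f \o T (s i)) (fun j => f \o T (rep j)) theta delta) => //.
    - by move=> i; exact: observable_act.
    - by move=> j; exact: observable_act.
    - move=> i; have [Lr cr] : [set w | L w /\ c w = c (s i)] (rep (c (s i))).
        by apply: xgetPex; exists (s i).
      exact/ltW/cP.
  apply; rewrite lerD2l ler_wpM2l// lnt; lra.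
apply: limn_esup_le; exists (Num.bound (2 * C / e)).+1 => // k /= kb.
rewrite lee_fin entropy_join_pullback.
have k0 : 0 < k%:R :> R by rewrite ltr0n (leq_trans _ kb).
rewrite mulrC ler_pdivrMr// (le_trans (bound k))//.
have : 2 * C / e < k%:R.
  apply: (@lt_le_trans _ _ (Num.bound (2 * C / e))%:R).
    by rewrite archi_boundP// divr_ge0 ?(ltW e0)// mulr_ge0.
  by rewrite ler_nat ltnW.
by rewrite ltr_pdivrMr//; lra.
Qed.

(** A supremum over the empty set would be -oo, whence the partition into one
    cell. *)
Lemma null_of_discrete_spectrum (beta b : R) : 0 < b ->
  directional_discrete_spectrum X beta b -> directional_null X beta.
Proof.
move=> b0 ds b' b'0 s _ sL.
have ap n (f : borel X -> 'I_n) : observable f -> almost_periodic_along (strip beta b') f.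
  move=> mf; apply: (almost_periodic_along_strip _ b0 mf).
  apply: almost_periodic_of_cells => // a.
  have : directional_kronecker beta b (f @^-1` [set a]).
    by rewrite (ds : directional_kronecker beta b = _); exact: mf.
  move=> [mB /compact_orbit_iff].
  congr (almost_periodic_along _ _); apply/funext => x.
  by apply/idP/eqP => [/set_mem//|fa]; exact: mem_set.
have partition1 : measurable_partition (fun i : 'I_1 => (fun=> ord0 : 'I_1) @^-1` [set i]
    : set (borel X)).
  apply: measurable_partition_index => i; last by exists point; rewrite [i]ord1.
  by rewrite (_ : _ @^-1` _ = setT)//; apply/seteqP; split=> // x _ /=; rewrite [i]ord1.
apply/eqP; rewrite eq_le; apply/andP; split.
  apply: ge_ereal_sup => _ [n [A [/index_of_partition[f mf ->] ->]]].
  by rewrite (seq_entropy_of_eq0 mf (ap _ _ mf) sL).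
apply: ereal_sup_ubound; exists 1%N, (fun i : 'I_1 => (fun=> ord0 : 'I_1) @^-1` [set i]).
split=> //; have [f mf fE] := index_of_partition partition1.
by rewrite fE (seq_entropy_of_eq0 mf (ap _ _ mf) sL).
Qed.

(** Otherwise each w in L but not in l would have its translate of the cell a
    within e/2 of a union S w of cells of the itinerary along l.  There are
    finitely many S, so S w classifies these w at scale e; the members of l are
    classified by their index.  The sequence nth w l lists l and then w. *)
Lemma exists_entropy_increasing_translate (L : set (int * int)) (I : finType)
    (f : borel X -> I) a (e : R) : observable f -> 0 < e ->
    ~ finitely_many_translates L (fun x => f x == a) e ->
  forall l : seq (int * int), exists w, [/\ L w, w \notin l &
    e / 2 <= obs_entropy mu (itinerary f (nth w l) (size l).+1) -
             obs_entropy mu (itinerary f (nth w l) (size l))].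
Proof.
move=> mf e0 nap l; apply: contrapT => no; apply: nap.
pose k := size l.
have mfa : observable (fun x => f x == a).
  exact: (observable_comp mf (fun b => b == a)).
have /choice[S SP] w : exists S : {set {ffun 'I_k -> I}}, L w -> w \notin l ->
    disagree mu ((fun x => f x == a) \o T w)
      (fun x => itinerary f (nth (0, 0) l) k x \in S) < e / 2.
  have [wl|wl] := boolP (w \in l); first by exists finset.set0.
  pose g (z : {ffun 'I_k.+1 -> I}) : {ffun 'I_k -> I} :=
    [ffun i : 'I_k => z (widen_ord (leqnSn k) i)].
  have [S SP] := exists_coarse_guess mu g (fun z => z ord_max == a)
    (observable_itinerary (nth w l) (k := k.+1) mf).
  exists S => Lw _.
  have E : g \o itinerary f (nth w l) k.+1 = itinerary f (nth w l) k.
    by apply/funext => x; apply/ffunP => i; rewrite !ffunE.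
  rewrite E in SP; move: SP; set gain := _ - _.
  have -> : (fun z : {ffun 'I_k.+1 -> I} => z ord_max == a) \o
      itinerary f (nth w l) k.+1 = (fun x => f x == a) \o T w.
    by apply/funext => x /=; rewrite ffunE /= nth_default.
  have -> : (fun x => g (itinerary f (nth w l) k.+1 x) \in S) =
      (fun x => itinerary f (nth (0, 0) l) k x \in S).
    apply/funext => x; have /(congr1 (@^~ x)) /= -> := E; congr (_ \in S).
    by apply/ffunP => i; rewrite !ffunE (set_nth_default (0, 0)).
  move=> /le_lt_trans; apply; rewrite ltNge; apply/negP => eg.
  by apply: no; exists w.
exists ('I_k.+1 * {set {ffun 'I_k -> I}})%type, (fun w => (inord (index w l), S w)).
move=> w u Lw Lu [/(congr1 (@nat_of_ord _))].
rewrite !inordK ?ltnS ?index_size// => wu Swu.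
have [wl|wl] := boolP (w \in l).
  have ul : u \in l by rewrite -index_mem -wu index_mem.
  by rewrite -(nth_index (0, 0) wl) wu nth_index// disagreexx.
have ul : u \notin l by rewrite -index_mem -wu index_mem.
have mS (S' : {set {ffun 'I_k -> I}}) :
    observable (fun x => itinerary f (nth (0, 0) l) k x \in S').
  exact: (observable_comp (observable_itinerary _ mf) (fun z => z \in S')).
apply: (le_lt_trans (disagree_triangle mu (observable_act w mfa) (mS (S w))
  (observable_act u mfa))).
rewrite [e]splitr ltrD ?SP// disagreeC Swu; exact: SP.
Qed.

(** The sequence is built by course-of-values recursion: hist n is the list of
    its first n terms, and each new term is chosen to raise the entropy. *)
Lemma exists_positive_entropy_sequence (L : set (int * int)) (I : finType)
    (f : borel X -> I) a : observable f ->
    ~ almost_periodic_along L (fun x => f x == a) ->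
  exists (s : nat -> int * int) (c : R), [/\ injective s, forall i, L (s i), 0 < c &
    forall k, k%:R * c <= obs_entropy mu (itinerary f s k)].
Proof.
move=> mf /existsNP[e /not_implyP[e0 nap]].
have /choice[next nextP] := exists_entropy_increasing_translate mf e0 nap.
pose hist n := iter n (fun l => rcons l (next l)) [::].
pose s n := next (hist n).
have histE n : hist n = mkseq s n.
  by elim: n => // n IHn; rewrite mkseqS -IHn.
have sP n : [/\ L (s n), s n \notin mkseq s n &
    e / 2 <= obs_entropy mu (itinerary f s n.+1) -
             obs_entropy mu (itinerary f s n)].
  have := nextP (hist n); rewrite -/(s n) histE size_mkseq => -[Ls sn h].
  split=> //; apply: (le_trans h).
  suff E k : (k <= n.+1)%N ->
      itinerary f (nth (s n) (mkseq s n)) k = itinerary f s k.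
    by rewrite !E.
  move=> kn; apply/funext => x; apply/ffunP => i; rewrite !ffunE.
  have := leq_trans (ltn_ord i) kn; rewrite ltnS leq_eqVlt => /predU1P[->|im].
    by rewrite nth_default// size_mkseq.
  by rewrite nth_mkseq.
exists s, (e / 2); split; last 2 first.
- exact: divr_gt0.
- elim=> [|k IHk].
    by rewrite mul0r obs_entropy_ge0//; exact: observable_itinerary.
  have [_ _] := sP k; rewrite -[k.+1%:R]natr1 mulrDl mul1r; lra.
- have neq i j : (i < j)%N -> s i <> s j.
    move=> ij sij; have [_ /negP] := sP j; case; rewrite -sij.
    by apply: map_f; rewrite mem_iota.
  move=> i j sij; case: (ltngtP i j) => // /neq; first by rewrite sij.
  by rewrite sij.
- by move=> i; have [] := sP i.
Qed.

(** For a set B of non-precompact orbit, the sequence above contradicts nullity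
    on the partition of B and its complement, both nonempty since the orbit of
    a constant function is a point. *)
Lemma discrete_spectrum_of_null (beta b : R) : 0 < b ->
  directional_null X beta -> directional_discrete_spectrum X beta b.
Proof.
move=> b0 null; apply/seteqP; split => [B [mB _]//|B mB].
exists mB; apply/compact_orbit_iff; apply: contrapT => nap.
pose f (x : borel X) : 'I_2 := if x \in B then ord_max else ord0.
have fB x : (f x == ord_max) = (x \in B) by rewrite /f; case: ifP.
have mf : observable f.
  exact: (observable_comp (observable_in mB)
    (fun c : bool => if c then ord_max else ord0)).
have nap' : ~ almost_periodic_along (strip beta b) (fun x => f x == ord_max).
  by rewrite (_ : (fun _ => _) = (fun x => x \in B)); last exact/funext.
have fs (i : 'I_2) : exists x, f x = i.
  apply: contrapT => /forallNP fi; apply: nap' => e e0.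
  exists unit, (fun=> tt) => w u _ _ _.
  suff -> : (fun x => f x == ord_max) \o T w = (fun x => f x == ord_max) \o T u.
    by rewrite disagreexx.
  have cst x y : f x = f y.
    have two (p q : 'I_2) : p != i -> q != i -> p = q.
      by case: i p q {fi} => [[|[|//]] ?] [[|[|//]] ?] [[|[|//]] ?] // _ _;
        exact: val_inj.
    by apply: two; apply/eqP; exact: fi.
  by apply/funext => x /=; rewrite (cst (T w x) (T u x)).
have [s [c [si sL c0 cP]]] := exists_positive_entropy_sequence mf nap'.
have := null b b0 s si sL.
have : (c%:E <= seq_entropy X s :> \bar R)%E.
  apply: (@le_trans _ _ (seq_entropy_of s (fun i => f @^-1` [set i]))).
    apply: limn_esup_ge; exists 1%N => // k /= k1.
    by rewrite lee_fin entropy_join_pullback mulrC ler_pdivlMr ?ltr0n// mulrC.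
  apply: ereal_sup_ubound; exists 2%N, (fun i => f @^-1` [set i]); split=> //.
  exact: measurable_partition_index.
by move=> + h; rewrite h lee_fin leNgt c0.
Qed.

End Main.

Theorem theorem1p4 (R : realType) (X : Z2MPS R) (beta b : R) (hb : 0 < b) :
  directional_discrete_spectrum X beta b <-> directional_null X beta.
Proof.
by split; [exact: null_of_discrete_spectrum|exact: discrete_spectrum_of_null].
Qed.
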